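(* Let $C$ denote the middle-thirds Cantor set. Then: (1) Every $u \in [0,1]$ can be written as $u = x^2 y$ for some $x,y \in C$. (2) The set of quotients from $C$ is \[ \left\{ \frac xy : x,y \in C,\ y \neq 0\right\} = \bigcup_{m=-\infty}^{\infty} \left[\tfrac23 \cdot 3^m, \tfrac32 \cdot 3^m\right]. \] (3) The set $\{xy : x,y \in C\}$ is a closed subset of $[0,1]$ whose Lebesgue measure is strictly greater than $\tfrac{17}{21}$.
   Context: The Cantor set is $C = \left\{\sum_{k=1}^\infty \alpha_k 3^{-k} : \alpha_k \in \{0,2\} \text{ for all } k\right\}$, i.e. the set of $x\in[0,1]$ admitting a ternary expansion using only the digits $0$ and $2$.
   Formalization: In (2), the point 0 is added to the right-hand side: since 0 = 0/1 is a quotient of elements of C but lies in none of the intervals, the set of quotients is stated to equal {0} together with the union of the intervals. *)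

(* Defs.v *)
From HB Require Import structures.
From mathcomp Require Import all_boot all_order all_algebra.
From mathcomp Require Import all_classical all_reals all_analysis.
Set Implicit Arguments. Unset Strict Implicit. Unset Printing Implicit Defensive.
Import Order.TTheory GRing.Theory Num.Theory.
Import numFieldNormedType.Exports.
Local Open Scope classical_set_scope.
Local Open Scope ring_scope.

Definition cantor_set (R : realType) : set R :=
  [set x | exists a : nat -> bool,
     (fun n => \sum_(0 <= k < n) ((a k)%:R * 2 / 3 ^+ k.+1 : R)) @ \oo --> x].

(* Main.v *)
(* A nonzero element of the Cantor set C is a power of 3 times an element of
   C lying in [2/3, 1], so everything happens there.  For F(x, y) = x^2 y or x / y and
   intervals I, J of [2/3, 1] of equal length, the image F(I, J) is the union of the
   images of the four pairs obtained by deleting the middle thirds of I and J;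
   choosing a pair at each level gives the digits of x and y with F(x, y)
   prescribed.  This settles (1) and (2).
   For F(x, y) = x y the same holds when I lies to the left of J, but for
   I = J = [a, a + 3t] the interval of length t^2 between (a + t)(a + 3t) and
   (a + 2t)^2 is lost.  Summing over the 2^k diagonal pairs of each level, at
   most 1/63 of [4/9, 1] is lost, with strict inequality because one of the
   lost intervals is covered by products of elements taken from different
   thirds.  Products outside [4/9, 1] lie in the dilates [4/9, 1] / 3^n, so the
   total measure exceeds (3/2)(5/9 - 1/63) = 17/21. *)

Require Import Defs.
From HB Require Import structures.
From mathcomp Require Import all_boot all_order all_algebra.
From mathcomp Require Import all_classical all_reals all_analysis.
From mathcomp Require Import measurable_realfun ring lra.
Import Order.TTheory GRing.Theory Num.Theory.
Import numFieldNormedType.Exports.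
Local Open Scope classical_set_scope.
Local Open Scope ring_scope.

Section CantorSet.
Set Implicit Arguments. Unset Strict Implicit.
Variable R : realType.
Implicit Types (a b s x y z : R) (d : nat -> bool).

Notation cantor := (@cantor_set R).

Definition cantor_sum d (n : nat) : R :=
  \sum_(0 <= k < n) ((d k)%:R * 2 / 3 ^+ k.+1 : R).

Lemma cantor_sumS d n :
  cantor_sum d n.+1 = cantor_sum d n + (d n)%:R * 2 / 3 ^+ n.+1.
Proof. by rewrite /cantor_sum big_nat_recr. Qed.

Lemma cantor_sum_shift d n :
  cantor_sum d n.+1 = ((d 0%N)%:R * 2 + cantor_sum (d \o S) n) / 3.
Proof.
rewrite /cantor_sum big_nat_recl// mulrDl expr1; congr (_ + _).
rewrite big_distrl /=; apply: eq_bigr => k _.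
by rewrite [in LHS]exprSr invfM !mulrA.
Qed.

Lemma cantor_sum_ge0 d n : 0 <= cantor_sum d n.
Proof. by apply: sumr_ge0 => k _; rewrite divr_ge0// mulr_ge0. Qed.

Lemma cantor_sum_le d n : cantor_sum d n <= 1 - 3^-1 ^+ n.
Proof.
elim: n => [|n IHn]; first by rewrite /cantor_sum big_geq// expr0 subrr.
rewrite cantor_sumS exprVn exprS invfM -exprVn.
move: IHn; set t := 3^-1 ^+ n => IHn.
have t0 : 0 < t by rewrite exprn_gt0.
by case: (d n) => /=; lra.
Qed.

Lemma cantor_sum_le1 d n : cantor_sum d n <= 1.
Proof.
by rewrite (le_trans (cantor_sum_le d n))// gerBl exprn_ge0.
Qed.

Lemma cvgn_cantor_sum d : exists x, cantor_sum d @ \oo --> x.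
Proof.
exists (limn (cantor_sum d)); apply: nondecreasing_is_cvgn.
  apply/nondecreasing_seqP => n; rewrite cantor_sumS lerDl.
  by rewrite divr_ge0// mulr_ge0.
by exists 1 => _ [n _ <-]; exact: cantor_sum_le1.
Qed.

Lemma cvgn_le (u : nat -> R) x c : u @ \oo --> x -> (forall n, u n <= c) -> x <= c.
Proof.
move=> ux uc; rewrite -(cvg_lim _ ux)//; apply: limr_le; last exact: nearW.
by apply/cvg_ex; exists x.
Qed.

Lemma cvgn_ge (u : nat -> R) x c : u @ \oo --> x -> (forall n, c <= u n) -> c <= x.
Proof.
move=> ux uc; rewrite -(cvg_lim _ ux)//; apply: limr_ge; last exact: nearW.
by apply/cvg_ex; exists x.
Qed.

Lemma cantor_itv x : cantor x -> 0 <= x <= 1.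
Proof.
move=> [d dx]; apply/andP; split.
  exact: (@cvgn_ge (cantor_sum d) _ _ dx (cantor_sum_ge0 d)).
exact: (@cvgn_le (cantor_sum d) _ _ dx (cantor_sum_le1 d)).
Qed.

Lemma cantor_split x : cantor x -> cantor (3 * x) \/ cantor (3 * x - 2).
Proof.
move=> [d dx].
have dSx : cantor_sum (d \o S) @ \oo --> 3 * x - (d 0%N)%:R * 2.
  have -> : cantor_sum (d \o S) =
      fun n => 3 * cantor_sum d n.+1 - (d 0%N)%:R * 2.
    by apply/funext => n; rewrite cantor_sum_shift; field.
  apply: cvgB; last exact: cvg_cst.
  apply: cvgM; first exact: cvg_cst.
  by rewrite (cvg_shiftS (cantor_sum d)).
case: (d 0%N) dSx => /= dSx; [right|left]; exists (d \o S).
  by rewrite mul1r in dSx.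
by rewrite mul0r subr0 in dSx.
Qed.

Lemma cantor_cons (i : bool) x : cantor x -> cantor ((i%:R * 2 + x) / 3).
Proof.
move=> [d dx]; exists (fun n => if n is m.+1 then d m else i).
rewrite -(cvg_shiftS (cantor_sum _)).
under eq_fun do rewrite cantor_sum_shift.
by apply: cvgM; [apply: cvgD => //; exact: cvg_cst | exact: cvg_cst].
Qed.

Lemma cvgn_div_exp3 s : s / 3 ^+ n @[n --> \oo] --> 0.
Proof.
under eq_fun do rewrite -exprVn.
by apply: cvg_geometric; rewrite gtr0_norm ?invr_gt0// invf_lt1// ltr1n.
Qed.

(* Selecting digits forever: the invariant [S a b s] speaks of the pair of
   intervals [a, a + s] and [b, b + s]. *)
Lemma cantor_select (S : R -> R -> R -> Prop) a b s :
    (forall a b s, S a b s -> exists i j : bool,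
      S (a + i%:R * (2 / 3 * s)) (b + j%:R * (2 / 3 * s)) (s / 3)) ->
    S a b s ->
  exists u v : nat -> R, exists x y : R,
    [/\ cantor x, cantor y, u @ \oo --> a + s * x, v @ \oo --> b + s * y
      & forall n, S (u n) (v n) (s / 3 ^+ n)].
Proof.
move=> stepS Sabs.
pose next (p : R * R * R) (q : bool * bool) : R * R * R :=
  (p.1.1 + q.1%:R * (2 / 3 * p.2), p.1.2 + q.2%:R * (2 / 3 * p.2), p.2 / 3).
pose T (p : R * R * R) := S p.1.1 p.1.2 p.2.
have /choice[g gT] : forall p, exists q, T p -> T (next p q).
  move=> p; have [Tp|nTp] := pselect (T p); last by exists (true, true).
  by have [i [j Sij]] := stepS _ _ _ Tp; exists (i, j).
pose st n := iter n (fun p => next p (g p)) (a, b, s).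
have stT n : T (st n) by elim: n => // n IHn; exact: gT.
have st2 n : (st n).2 = s / 3 ^+ n.
  elim: n => [|n IHn]; first by rewrite expr0 divr1.
  by rewrite /= IHn exprSr invfM mulrA.
pose d1 n := (g (st n)).1; pose d2 n := (g (st n)).2.
have st11 n : (st n).1.1 = a + s * cantor_sum d1 n.
  elim: n => [|n IHn]; first by rewrite /cantor_sum big_geq// mulr0 addr0.
  rewrite cantor_sumS [LHS]/= -/(d1 n) -/(st n) IHn st2 exprS.
  by field; rewrite expf_neq0.
have st12 n : (st n).1.2 = b + s * cantor_sum d2 n.
  elim: n => [|n IHn]; first by rewrite /cantor_sum big_geq// mulr0 addr0.
  rewrite cantor_sumS [LHS]/= -/(d2 n) -/(st n) IHn st2 exprS.
  by field; rewrite expf_neq0.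
have [x d1x] := cvgn_cantor_sum d1; have [y d2y] := cvgn_cantor_sum d2.
exists (fun n => (st n).1.1), (fun n => (st n).1.2), x, y; split.
- by exists d1.
- by exists d2.
- under eq_fun do rewrite st11.
  by apply: cvgD; [exact: cvg_cst | apply: cvgM => //; exact: cvg_cst].
- under eq_fun do rewrite st12.
  by apply: cvgD; [exact: cvg_cst | apply: cvgM => //; exact: cvg_cst].
- by move=> n; rewrite -st2; exact: stT.
Qed.

Lemma cantor_coind (K : set R) :
    (forall x, K x -> 0 <= x <= 1) ->
    (forall x, K x -> K (3 * x) \/ K (3 * x - 2)) ->
  K `<=` cantor.
Proof.
move=> K01 Ksplit x Kx.
pose S a b s := 0 < s /\ K ((x - a) / s).
have stepS a b s : S a b s -> exists i j : bool,
    S (a + i%:R * (2 / 3 * s)) (b + j%:R * (2 / 3 * s)) (s / 3).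
  move=> [s0 /Ksplit Kxs]; have s_neq0 := lt0r_neq0 s0.
  case: Kxs => Kxs; [exists false, false|exists true, true].
    split; first by rewrite divr_gt0.
    by congr (K _): Kxs; rewrite /=; field.
  split; first by rewrite divr_gt0.
  by congr (K _): Kxs; rewrite /=; field.
have [|u [v [y [z [Cy Cz uy vz Suv]]]]] := @cantor_select S 0 0 1 stepS.
  by split=> //; rewrite subr0 divr1.
rewrite add0r mul1r in uy.
have uSn n : u n <= x <= u n + 1 / 3 ^+ n.
  have [s0 /K01] := Suv n.
  by rewrite ler_pdivlMr// ler_pdivrMr// mul0r !mul1r subr_ge0 lerBlDl.
have -> : x = y; last by [].
apply/le_anti/andP; split.
  have uy' : u n + 1 / 3 ^+ n @[n --> \oo] --> y.
    by rewrite -[X in _ --> X]addr0; apply: cvgD => //; exact: cvgn_div_exp3.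
  by apply: cvgn_ge uy' _ => n; case/andP: (uSn n).
by apply: cvgn_le uy _ => n; case/andP: (uSn n).
Qed.

Lemma cantor0 : cantor 0.
Proof.
have H : [set (0 : R)] `<=` cantor; last exact: H.
apply: cantor_coind => x /= ->; first by rewrite lexx ler01.
by left; rewrite mulr0.
Qed.

Lemma cantor1 : cantor 1.
Proof.
have H : [set (1 : R)] `<=` cantor; last exact: H.
apply: cantor_coind => x /= ->; first by rewrite lexx ler01.
by right; ring.
Qed.

Lemma closed_cantor : closed cantor.
Proof.
apply: cantor_coind => x.
  have : closure cantor `<=` closure (`[0, 1]%classic : set R).
    by apply: closureS => y /cantor_itv; rewrite /= in_itv.
  move=> /[apply]; rewrite -(closure_id _).1; last exact: itv_closed.
  by rewrite /= in_itv.
have affine (f : R -> R) : continuous f -> closed (f @^-1` closure cantor).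
  by move=> cf; apply: preimage_closed => [y _|]; [exact: cf|exact: closed_closure].
have : closure cantor `<=` closure
    ((fun y => 3 * y) @^-1` closure cantor `|`
     (fun y => 3 * y - 2) @^-1` closure cantor).
  by apply: closureS => y /cantor_split[] Cy; [left|right]; exact: subset_closure.
move=> /[apply]; rewrite -(closure_id _).1; first by case; [left|right].
apply: closedU; apply: affine => y.
  by apply: cvgM; [exact: cvg_cst|exact: cvg_id].
by apply: cvgB; [apply: cvgM; [exact: cvg_cst|exact: cvg_id]|exact: cvg_cst].
Qed.

Lemma compact_cantor : compact cantor.
Proof.
apply: (subclosed_compact closed_cantor (@segment_compact R 0 1)).
by move=> x /cantor_itv; rewrite /= in_itv.
Qed.

Lemma cantor_div_exp3 x n : cantor x -> cantor (x / 3 ^+ n).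
Proof.
move=> Cx; elim: n => [|n IHn]; first by rewrite expr0 divr1.
by move/(cantor_cons false): IHn; rewrite mul0r add0r exprSr invfM mulrA.
Qed.

Lemma scale_exp3 x : 0 < x <= 1 -> exists n, 3^-1 < x * 3 ^+ n <= 1.
Proof.
move=> /andP[x0 x1].
have [n xn] : exists n, 3^-1 < x * 3 ^+ n.
  have /cvgr_lt/(_ x x0)[n _ /(_ n (leqnn n))] := cvgn_div_exp3 3^-1.
  by rewrite /= ltr_pdivrMr ?exprn_gt0// => xn; exists n.
elim: n xn => [|n IHn] xn; first by exists 0%N; rewrite xn expr0 mulr1 x1.
have [//|xn'] := ltP 3^-1 (x * 3 ^+ n).
by exists n.+1; rewrite xn exprSr mulrA -ler_pdivlMr// mul1r.
Qed.

Lemma cantor_mul_exp3 x n : cantor x -> x * 3 ^+ n <= 1 -> cantor (x * 3 ^+ n).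
Proof.
move=> Cx; elim: n => [|n IHn]; first by rewrite expr0 mulr1.
rewrite exprSr mulrA => xn.
have x0 : 0 <= x * 3 ^+ n by case/andP: (cantor_itv Cx) => ? _; rewrite mulr_ge0.
have /IHn/cantor_split[] : x * 3 ^+ n <= 1 by lra.
  by rewrite mulrC.
by move/cantor_itv => /andP[? ?]; lra.
Qed.

Lemma cantor_scale x : cantor x -> x != 0 ->
  exists n, [/\ cantor (x * 3 ^+ n), 2 / 3 <= x * 3 ^+ n & x * 3 ^+ n <= 1].
Proof.
move=> Cx x_neq0; have /andP[x0 x1] := cantor_itv Cx.
have [|n /andP[xn xn1]] := @scale_exp3 x; first by rewrite lt0r x_neq0 x0 x1.
have Cxn := cantor_mul_exp3 Cx xn1; exists n; split=> //.
have [/cantor_itv/andP[_ ?]|/cantor_itv/andP[? _]] := cantor_split Cxn; lra.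
Qed.

End CantorSet.

Section CantorArithmetic.
Set Implicit Arguments. Unset Strict Implicit.
Variable R : realType.
Implicit Types (a b s t x y z : R).

Notation cantor := (@cantor_set R).

Definition cantor_cell a s := forall x, cantor x -> cantor (a + s * x).

Lemma cantor_cell01 : cantor_cell 0 1.
Proof. by move=> x Cx; rewrite add0r mul1r. Qed.

Lemma cantor_cell_sub a s (i : bool) :
  cantor_cell a s -> cantor_cell (a + i%:R * (2 / 3 * s)) (s / 3).
Proof.
move=> Cas x /(cantor_cons i)/Cas; congr (cantor _).
by field.
Qed.

Lemma cantor_cellL a s : cantor_cell a s -> cantor_cell a (s / 3).
Proof. by move=> /(cantor_cell_sub false); rewrite mul0r addr0. Qed.

Lemma cantor_cellR a s : cantor_cell a s -> cantor_cell (a + 2 / 3 * s) (s / 3).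
Proof. by move=> /(cantor_cell_sub true); rewrite mul1r. Qed.

Lemma cantor_solve (F : R -> R -> R) (S : R -> R -> R -> Prop) (c a b s : R) :
    (forall (u v : nat -> R) x y, u @ \oo --> x -> v @ \oo --> y ->
      F (u n) (v n) @[n --> \oo] --> F x y) ->
    (forall a b s, S a b s -> - (c * s) <= F a b <= c * s) ->
    (forall a b t, S a b (3 * t) ->
      [\/ S a b t, S a (b + 2 * t) t, S (a + 2 * t) b t
        | S (a + 2 * t) (b + 2 * t) t]) ->
    0 <= s -> cantor_cell a s -> cantor_cell b s -> S a b s ->
  exists x y, [/\ cantor x, cantor y, a <= x, b <= y & F x y = 0].
Proof.
move=> Fcvg FS stepS s0 Cas Cbs Sabs.
have stepS' a' b' s' : S a' b' s' -> exists i j : bool,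
    S (a' + i%:R * (2 / 3 * s')) (b' + j%:R * (2 / 3 * s')) (s' / 3).
  have -> : 2 / 3 * s' = 2 * (s' / 3) by field.
  have {1}-> : s' = 3 * (s' / 3) by field.
  case/stepS => Sab; [exists false, false|exists false, true
    |exists true, false|exists true, true]; by rewrite ?mul0r ?addr0 ?mul1r.
have [u [v [x [y [Cx Cy ux vy Suv]]]]] := cantor_select stepS' Sabs.
exists (a + s * x), (b + s * y); split; [exact: Cas|exact: Cbs| | |].
- by rewrite lerDl mulr_ge0//; case/andP: (cantor_itv Cx).
- by rewrite lerDl mulr_ge0//; case/andP: (cantor_itv Cy).
have Fuv := Fcvg _ _ _ _ ux vy.
have c0 : c * (s / 3 ^+ n) @[n --> \oo] --> 0.
  rewrite -(mulr0 c); apply: cvgM; first exact: cvg_cst.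
  exact: cvgn_div_exp3.
apply/le_anti/andP; split.
  apply: (ler_cvg_to Fuv c0).
  by apply: nearW => n; case/andP: (FS _ _ _ (Suv n)).
have c0N : - (c * (s / 3 ^+ n)) @[n --> \oo] --> 0.
  by rewrite -oppr0; apply: cvgN.
apply: (ler_cvg_to c0N Fuv).
by apply: nearW => n; case/andP: (FS _ _ _ (Suv n)).
Qed.

Lemma cantor_cell23 : cantor_cell (2 / 3) 3^-1.
Proof. by move: (cantor_cellR cantor_cell01); rewrite add0r mulr1 mul1r. Qed.

Let third_ge0 : 0 <= 3^-1 :> R.
Proof. by rewrite invr_ge0. Qed.

Lemma step_sqM a b t : 0 < t -> 2 / 3 <= a -> a + 3 * t <= 1 -> 2 / 3 <= b ->
  b + 3 * t <= 1 ->
  [/\ a ^+ 2 * (b + 2 * t) <= (a + t) ^+ 2 * (b + t),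
      (a + 2 * t) ^+ 2 * b <= (a + t) ^+ 2 * (b + 3 * t)
    & (a + 2 * t) ^+ 2 * (b + 2 * t) <= (a + 3 * t) ^+ 2 * (b + t)].
Proof.
move=> t0 a0 a1 b0 b1.
have ab : 0 <= a * (2 * b - a) by apply: mulr_ge0; lra.
have ta : 0 <= t * (3 * a - 2) by apply: mulr_ge0; lra.
have tb : 0 <= t * (3 * b - 2) by apply: mulr_ge0; lra.
have ta1 : 0 <= t * (1 - a) by apply: mulr_ge0; lra.
have tb1 : 0 <= t * (1 - b) by apply: mulr_ge0; lra.
have aa : 0 <= a * (3 * a - 2) by apply: mulr_ge0; lra.
have ab1 : 0 <= a * (1 - b) by apply: mulr_ge0; lra.
have tt : 0 <= t * t by apply: mulr_ge0; lra.
split; rewrite -subr_ge0.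
- have -> : (a + t) ^+ 2 * (b + t) - a ^+ 2 * (b + 2 * t) =
    t * (2 * a * b + 2 * a * t + t * b + t * t - a * a) by ring.
  by apply: mulr_ge0; lra.
- have -> : (a + t) ^+ 2 * (b + 3 * t) - (a + 2 * t) ^+ 2 * b =
    t * (3 * a * a + 6 * a * t + 3 * t * t - 2 * a * b - 3 * t * b) by ring.
  by apply: mulr_ge0; lra.
- have -> : (a + 3 * t) ^+ 2 * (b + t) - (a + 2 * t) ^+ 2 * (b + 2 * t) =
    t * (2 * a * b - a * a + 5 * t * b - 2 * a * t + t * t) by ring.
  by apply: mulr_ge0; lra.
Qed.

Lemma cantor_sqM_itv z : 8 / 27 <= z <= 1 ->
  exists x y, [/\ cantor x, cantor y & z = x ^+ 2 * y].
Proof.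
move=> /andP[z0 z1].
pose S a b s := [/\ 0 < s, 2 / 3 <= a <= 1 - s, 2 / 3 <= b <= 1 - s
  & a ^+ 2 * b <= z <= (a + s) ^+ 2 * (b + s)].
have [||||x [y [Cx Cy ax b_y xyz]]] := @cantor_solve (fun x y => x ^+ 2 * y - z) S 3
    (2 / 3) (2 / 3) 3^-1 _ _ _ third_ge0 cantor_cell23 cantor_cell23.
- move=> u v x y ux vy; apply: cvgB; last exact: cvg_cst.
  by apply: cvgM => //; under eq_fun do rewrite expr2; exact: cvgM.
- move=> a b s [s0 /andP[a0 a1] /andP[b0 b1] /andP[zl zu]].
  have E : (a + s) ^+ 2 * (b + s) - a ^+ 2 * b =
    3 * s - s * ((1 - (a + s)) * (1 + (a + s)) + (1 - b) * (2 * a + s) + (2 - 2 * a - s)).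
    by ring.
  have : 0 <= s * ((1 - (a + s)) * (1 + (a + s)) + (1 - b) * (2 * a + s) + (2 - 2 * a - s)).
    by apply: mulr_ge0; [lra|apply: addr_ge0; [apply: addr_ge0; apply: mulr_ge0|]; lra].
  move=> ?; apply/andP; split; lra.
- move=> a b t [t0 /andP[a0 a1] /andP[b0 b1] /andP[zl zu]].
  have [|||||LH HL HH] := @step_sqM a b t; try lra.
  have [z00|z00] := leP z ((a + t) ^+ 2 * (b + t)).
    by constructor 1; split; try (apply/andP; split); lra.
  have [z01|z01] := leP z ((a + t) ^+ 2 * (b + 3 * t)).
    by constructor 2; split; try (apply/andP; split); lra.
  have [z10|z10] := leP z ((a + 3 * t) ^+ 2 * (b + t)).
    by constructor 3; split; try (apply/andP; split); lra.
  by constructor 4; split; try (apply/andP; split); lra.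
- by split; try (apply/andP; split); lra.
- by exists x, y; split=> //; apply/esym/subr0_eq.
Qed.

Lemma cantor_sqM u : 0 <= u <= 1 ->
  exists x y, cantor x /\ cantor y /\ u = x ^+ 2 * y.
Proof.
move=> /andP[u0 u1]; have [->|u_neq0] := eqVneq u 0.
  by exists 0, 0; rewrite expr2 !mulr0; do !split; exact: cantor0.
have [|n /andP[un un1]] := @scale_exp3 R u; first by rewrite lt0r u_neq0 u0 u1.
have [|x [y [Cx Cy E]]] := @cantor_sqM_itv (u * 3 ^+ n); first lra.
exists x, (y / 3 ^+ n); split=> //; split; first exact: cantor_div_exp3.
by rewrite mulrA -E mulfK// expf_neq0.
Qed.

Lemma slope_lt_le z (p p' q q' : R) :
  0 < q -> 0 < q' -> p' * q <= p * q' -> p < z * q -> p' <= z * q'.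
Proof.
move=> q0 q'0 pq; rewrite -ltr_pdivrMr// -ler_pdivrMr// => /ltW; apply: le_trans.
by rewrite ler_pdivlMr// mulrAC ler_pdivrMr.
Qed.

Lemma step_div z a b t :
    0 < t -> 2 / 3 <= a -> a <= 1 -> 2 / 3 <= b -> b <= 1 ->
    a <= z * (b + 3 * t) -> z * b <= a + 3 * t ->
  [\/ a <= z * (b + t) /\ z * b <= a + t,
      a <= z * (b + 3 * t) /\ z * (b + 2 * t) <= a + t,
      a + 2 * t <= z * (b + t) /\ z * b <= a + 3 * t
    | a + 2 * t <= z * (b + 3 * t) /\ z * (b + 2 * t) <= a + 3 * t].
Proof.
move=> t0 a0 a1 b0 b1 zl zu.
have tt : 0 < t * t by rewrite mulr_gt0.
have ta : 0 <= t * (3 * a - 2) by apply: mulr_ge0; lra.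
have tb : 0 <= t * (3 * b - 2) by apply: mulr_ge0; lra.
have ta1 : 0 <= t * (1 - a) by apply: mulr_ge0; lra.
have tb1 : 0 <= t * (1 - b) by apply: mulr_ge0; lra.
have [z01|z01] := leP (z * (b + 2 * t)) (a + t); first by constructor 2.
have [ba|ab] := leP (b + t) a.
  have tba : 0 <= t * (a - (b + t)) by apply: mulr_ge0; lra.
  have [z11|z11] := leP (z * (b + 2 * t)) (a + 3 * t).
    by constructor 4; split=> //; apply: slope_lt_le z01; lra.
  have [z00|z00] := leP (z * b) (a + t).
    by constructor 1; split=> //; apply: slope_lt_le z11; lra.
  by constructor 3; split=> //; apply: slope_lt_le z00; lra.
have tab : 0 <= t * (b + t - a) by apply: mulr_ge0; lra.
have [z00|z00] := leP (z * b) (a + t).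
  by constructor 1; split=> //; apply: slope_lt_le z01; lra.
have [ba'|ab'] := leP b (a + t).
  have tba : 0 <= t * (a + t - b) by apply: mulr_ge0; lra.
  by constructor 3; split=> //; apply: slope_lt_le z00; lra.
have tba : 0 <= t * (b - (a + t)) by apply: mulr_ge0; lra.
have [z11|z11] := leP (z * (b + 2 * t)) (a + 3 * t).
  by constructor 4; split=> //; apply: slope_lt_le z00; lra.
by constructor 3; split=> //; apply: slope_lt_le z11; lra.
Qed.

Lemma cantor_div_itv z : 2 / 3 <= z <= 3 / 2 ->
  exists x y, [/\ cantor x, cantor y, y != 0 & z = x / y].
Proof.
move=> /andP[z0 z1].
pose S a b s := [/\ 0 < s, 2 / 3 <= a <= 1 - s, 2 / 3 <= b <= 1 - s
  & a <= z * (b + s) /\ z * b <= a + s].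
have [||||x [y [Cx Cy ax b_y xyz]]] := @cantor_solve (fun x y => x - z * y) S (1 + z)
    (2 / 3) (2 / 3) 3^-1 _ _ _ third_ge0 cantor_cell23 cantor_cell23.
- move=> u v x y ux vy; apply: cvgB => //.
  by apply: cvgM => //; exact: cvg_cst.
- move=> a b s [s0 _ _ [zl zu]].
  have zs : 0 <= z * s by apply: mulr_ge0; lra.
  by apply/andP; split; lra.
- move=> a b t [t0 /andP[a0 a1] /andP[b0 b1] [zl zu]].
  case: (@step_div z a b t); try lra; move=> [? ?];
    [constructor 1|constructor 2|constructor 3|constructor 4];
    by split; (try (apply/andP)); try split; lra.
- by split; (try (apply/andP)); try split; lra.
have y_neq0 : y != 0.
  by apply: lt0r_neq0; lra.
by exists x, y; split=> //; rewrite (subr0_eq xyz) mulfK.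
Qed.

Lemma step_mul a b t : 0 < t -> 2 / 3 <= a -> a + t <= b -> b <= 1 ->
  [/\ a * (b + 2 * t) <= (a + t) * (b + t),
      (a + 2 * t) * b <= (a + t) * (b + 3 * t)
    & (a + 2 * t) * (b + 2 * t) <= (a + 3 * t) * (b + t)].
Proof.
move=> t0 a0 ab b1.
have ? : 0 <= t * (b - a - t) by apply: mulr_ge0; lra.
have ? : 0 <= t * (3 * a - b + 3 * t) by apply: mulr_ge0; lra.
have ? : 0 <= t * t by apply: mulr_ge0; lra.
by split; lra.
Qed.

Lemma cantor_mul_itv a b s z :
    0 < s -> 2 / 3 <= a -> a + s <= b -> b + s <= 1 ->
    cantor_cell a s -> cantor_cell b s ->
    a * b <= z <= (a + s) * (b + s) ->
  exists x y, [/\ cantor x, cantor y & z = x * y].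
Proof.
move=> s0 a0 ab b1 Cas Cbs zab.
pose S a b s := [/\ 0 < s, 2 / 3 <= a, a + s <= b <= 1 - s
  & a * b <= z <= (a + s) * (b + s)].
have [|||||x [y [Cx Cy _ _ xyz]]] := @cantor_solve (fun x y => x * y - z) S 3
    a b s _ _ _ _ Cas Cbs.
- by move=> u v x y ux vy; apply: cvgB; [exact: cvgM|exact: cvg_cst].
- move=> {s0 a0 ab b1 Cas Cbs zab}a {}b {}s [s0 a0 /andP[ab b1] /andP[zl zu]].
  have ? : 0 <= s * (3 - a - b - s) by apply: mulr_ge0; lra.
  by apply/andP; split; lra.
- move=> {s0 a0 ab b1 Cas Cbs zab}a {}b t [t0 a0 /andP[ab b1] /andP[zl zu]].
  have [||||LH HL HH] := @step_mul a b t; try lra.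
  have [z00|z00] := leP z ((a + t) * (b + t)).
    by constructor 1; split; try (apply/andP; split); lra.
  have [z01|z01] := leP z ((a + t) * (b + 3 * t)).
    by constructor 2; split; try (apply/andP; split); lra.
  have [z10|z10] := leP z ((a + 3 * t) * (b + t)).
    by constructor 3; split; try (apply/andP; split); lra.
  by constructor 4; split; try (apply/andP; split); lra.
- exact: ltW.
- by split=> //; apply/andP; split; lra.
- by exists x, y; split=> //; apply/esym/subr0_eq.
Qed.

End CantorArithmetic.

Section QuotientsAndProducts.
Set Implicit Arguments. Unset Strict Implicit.
Variable R : realType.
Implicit Types (a b c s t x y z : R).

Notation cantor := (@cantor_set R).
Notation mu := (@lebesgue_measure R).

Lemma cantor_quotients :
  [set z | exists x y, [/\ cantor x, cantor y, y != 0 & z = x / y]]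
  = [set 0] `|` \bigcup_(m in [set: int])
      `[(2 / 3) * (3:R) ^ m, (3 / 2) * (3:R) ^ m]%classic.
Proof.
apply/seteqP; split=> z /=.
  move=> [x [y [Cx Cy y_neq0 ->]]].
  have [->|x_neq0] := eqVneq x 0; first by left; rewrite mul0r.
  have [n [_ xn0 xn1]] := cantor_scale Cx x_neq0.
  have [m [_ ym0 ym1]] := cantor_scale Cy y_neq0.
  right; exists (m%:Z - n%:Z) => //=.
  rewrite in_itv /= expfzDr// -exprnN -exprnP.
  have -> : x / y = (x * 3 ^+ n) / (y * 3 ^+ m) * (3 ^+ m / 3 ^+ n).
    by field; rewrite !expf_neq0.
  have ym : 0 < y * 3 ^+ m by lra.
  have pos : 0 < 3 ^+ m / 3 ^+ n :> R by rewrite divr_gt0// exprn_gt0.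
  by rewrite !(ler_pM2r pos) ler_pdivlMr// ler_pdivrMr//; apply/andP; split; lra.
move=> [->|[m _]]; rewrite /= ?in_itv /=.
  exists 0, 1; split; rewrite ?oner_eq0 ?mul0r//; first exact: cantor0.
  exact: cantor1.
have pos : 0 < (3 : R) ^ m by rewrite exprz_gt0.
move=> z_itv.
have {}z_itv : 2 / 3 <= z / (3 : R) ^ m <= 3 / 2.
  by rewrite ler_pdivlMr// ler_pdivrMr.
have [x [y [Cx Cy y_neq0]]] := cantor_div_itv z_itv.
move=> /(canRL (divfK (lt0r_neq0 pos))) ->.
case: m {z_itv pos} => n.
  exists x, (y / 3 ^+ n); split=> //; first exact: cantor_div_exp3.
    by rewrite mulf_neq0// invr_neq0// expf_neq0.
  by rewrite -exprnP invfM invrK mulrA.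
exists (x / 3 ^+ n.+1), y; split=> //; first exact: cantor_div_exp3.
by rewrite NegzE -exprnN mulrAC.
Qed.

Let P := [set z | exists x y, [/\ cantor x, cantor y & z = x * y]].

Lemma closed_cantor_products : closed P.
Proof.
have -> : P = (fun p : R * R => p.1 * p.2) @` (cantor `*` cantor).
  apply/seteqP; split=> z /=.
    by move=> [x [y [Cx Cy ->]]]; exists (x, y).
  by move=> [[x y] /= [Cx Cy] <-]; exists x, y.
apply: compact_closed; first exact: norm_hausdorff.
apply: continuous_compact; last by apply: compact_setX; exact: compact_cantor.
by apply: continuous_subspaceT; exact: mul_continuous.
Qed.

Lemma cantor_products_itv : P `<=` `[0, 1]%classic.
Proof.
move=> _ [x [y [/cantor_itv/andP[x0 x1] /cantor_itv/andP[y0 y1] ->]]].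
by rewrite /= in_itv /= mulr_ge0//= mulr_ile1.
Qed.

Let measurable_products : measurable P.
Proof. exact: closed_measurable closed_cantor_products. Qed.

Lemma lebesgue_measure_segment x y : x <= y -> mu `[x, y]%classic = (y - x)%:E.
Proof.
rewrite le_eqVlt lebesgue_measure_itv /= lte_fin => /orP[/eqP ->|->] //.
by rewrite ltxx subrr.
Qed.

Definition square_defect c a s : \bar R :=
  mu (`[c * a ^+ 2, c * (a + s) ^+ 2]%classic `\` P).

Lemma square_defect_split c a s :
    (forall x y, cantor x -> cantor y -> P (c * (x * y))) ->
    0 < c -> 0 < s -> 2 / 3 <= a -> a + s <= 1 -> cantor_cell a s ->
  (square_defect c a s <= (c * (s / 3) ^+ 2)%:E +
    (square_defect c a (s / 3) + square_defect c (a + 2 / 3 * s) (s / 3)))%E.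
Proof.
move=> cP c0 s0 a0 a1 Cas; pose t := s / 3.
have s3 : s = 3 * t by rewrite /t; field.
have [t0 a2 a3] : [/\ 0 < t, a + 2 / 3 * s = a + 2 * t & a + 2 * t + t = a + s].
  by rewrite /t; split; lra.
have gap : 0 <= c * (a + 2 * t) ^+ 2 - c * ((a + t) * (a + 3 * t)).
  by rewrite (_ : _ - _ = c * t ^+ 2); [rewrite mulr_ge0// ?exprn_ge0// ltW|ring].
rewrite /square_defect a2 -/t a3.
have -> : (c * t ^+ 2)%:E =
    mu `[c * ((a + t) * (a + 3 * t)), c * (a + 2 * t) ^+ 2]%classic.
  rewrite lebesgue_measure_segment; last by rewrite -subr_ge0.
  by congr _%:E; ring.
set G := `[c * ((a + t) * (a + 3 * t)), _]%classic.
set L := `[_, c * (a + t) ^+ 2]%classic `\` P.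
set H := `[c * (a + 2 * t) ^+ 2, _]%classic `\` P.
have mI x y : measurable (`[x, y]%classic `\` P).
  by apply: measurableD => //; exact: measurable_itv.
have mG : measurable G by exact: measurable_itv.
have mLH : measurable (L `|` H) by apply: measurableU; exact: mI.
apply: (@le_trans _ _ (mu (G `|` (L `|` H)))); last first.
  apply: (@le_trans _ _ (mu G + mu (L `|` H))%E); first exact: measureU2.
  by rewrite leeD2l// measureU2//; exact: mI.
apply: le_measure; rewrite ?inE//; first exact: mI.
  exact: measurableU.
move=> z [/=]; rewrite !in_itv /= => /andP[zl zu] nPz.
have [zL|zL] := leP z (c * (a + t) ^+ 2).
  by right; left; split=> //=; rewrite in_itv /= zl zL.
have [zH|zH] := leP (c * (a + 2 * t) ^+ 2) z.
  by right; right; split=> //=; rewrite in_itv /= zu zH.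
left; rewrite /G /= in_itv /= (ltW zH) andbT leNgt; apply/negP => zM; apply: nPz.
have zc : z = c * (z / c) by rewrite mulrC divfK// lt0r_neq0.
have [|||||||x [y [Cx Cy xy]]] := @cantor_mul_itv R a (a + 2 * t) t (z / c).
- by [].
- by [].
- by lra.
- by lra.
- exact: cantor_cellL Cas.
- by rewrite -a2; exact: cantor_cellR Cas.
- rewrite ler_pdivlMr// ler_pdivrMr// mulrC.
  rewrite (_ : a + 2 * t + t = a + 3 * t); last by ring.
  rewrite [(_ * _) * c]mulrC (ltW zM) andbT (le_trans _ (ltW zL))//.
  by rewrite ler_pM2l// -subr_ge0 (_ : _ - _ = t ^+ 2) ?exprn_ge0 ?ltW//; ring.
- by rewrite zc xy; exact: cP.
Qed.

Lemma cvgn_gee (u : nat -> R) x (e : \bar R) :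
  (forall n, (e <= (u n)%:E)%E) -> u @ \oo --> x -> (e <= x%:E)%E.
Proof.
move=> eu ux; have eux : (u n)%:E @[n --> \oo] --> x%:E by apply: cvg_EFin => //; exact: nearW.
rewrite -(cvg_lim _ eux)//; apply: lime_ge; last exact: nearW.
by apply/cvg_ex; exists x%:E.
Qed.

Lemma square_defect_le c a s :
    (forall x y, cantor x -> cantor y -> P (c * (x * y))) ->
    0 < c -> 0 < s -> 2 / 3 <= a -> a + s <= 1 -> cantor_cell a s ->
  (square_defect c a s <= (c * s ^+ 2 / 7)%:E)%E.
Proof.
move=> cP c0.
have bound n : forall a s, 0 < s -> 2 / 3 <= a -> a + s <= 1 -> cantor_cell a s ->
    (square_defect c a s <= (c * (s ^+ 2 / 7 + 2 * (2 / 3) ^+ n * s))%:E)%E.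
  elim: n => [|n IHn] {}a {}s s0 a0 a1 Cas.
    have sas : 0 <= s * (2 * a + s) by apply: mulr_ge0; lra.
    have aas : a ^+ 2 <= (a + s) ^+ 2 by lra.
    apply: (@le_trans _ _ (mu `[c * a ^+ 2, c * (a + s) ^+ 2]%classic)).
      apply: le_measure; rewrite ?inE.
      - by apply: measurableD => //; exact: measurable_itv.
      - exact: measurable_itv.
      - exact: subDsetl.
    rewrite lebesgue_measure_segment ?ler_pM2l// lee_fin -mulrBr ler_pM2l// expr0.
    have : 0 <= s * (2 - 2 * a - s) by apply: mulr_ge0; lra.
    have : 0 <= s ^+ 2 by rewrite exprn_ge0// ltW.
    by rewrite !expr2; lra.
  apply: (le_trans (square_defect_split cP c0 s0 a0 a1 Cas)).
  have s3 : 0 < s / 3 by rewrite divr_gt0.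
  have aL : a + s / 3 <= 1 by lra.
  have [aR aR1] : 2 / 3 <= a + 2 / 3 * s /\ a + 2 / 3 * s + s / 3 <= 1.
    by split; lra.
  have HL := IHn _ _ s3 a0 aL (cantor_cellL Cas).
  have HR := IHn _ _ s3 aR aR1 (cantor_cellR Cas).
  apply: (le_trans (leeD (lexx _) (leeD HL HR))).
  rewrite -!EFinD lee_fin (exprS _ n) -!mulrDr ler_pM2l//.
  by rewrite le_eqVlt; apply/orP; left; apply/eqP; field.
move=> s0 a0 a1 Cas.
apply: (@cvgn_gee (fun n => c * (s ^+ 2 / 7 + 2 * (2 / 3) ^+ n * s))).
  by move=> n; exact: bound.
have -> : c * s ^+ 2 / 7 = c * (s ^+ 2 / 7 + 2 * 0 * s) by field.
apply: cvgM; first exact: cvg_cst.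
apply: cvgD; first exact: cvg_cst.
apply: cvgM; last exact: cvg_cst.
apply: cvgM; first exact: cvg_cst.
by apply: cvg_expr; rewrite gtr0_norm//; lra.
Qed.

Lemma square_defect0 c a s :
    (forall z, c * a ^+ 2 <= z <= c * (a + s) ^+ 2 -> P z) ->
  square_defect c a s = 0%E.
Proof.
move=> aP; rewrite /square_defect (_ : _ `\` _ = set0) ?measure0//.
by apply/seteqP; split=> // z [/=]; rewrite in_itv /= => /aP.
Qed.

(* The gain over [square_defect_le] comes from the cell [188/243, 189/243],
   whose square is covered by the products of [2/3, 7/9] and [8/9, 1]. *)
Lemma square_defect1_le :
  (square_defect 1 (2 / 3) 3^-1 <= (63^-1 - (243 ^+ 2 * 7)^-1)%:E)%E.
Proof.
have P1 x y : cantor x -> cantor y -> P (1 * (x * y)).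
  by move=> Cx Cy; exists x, y; rewrite mul1r.
have merge a b s t (r1 r2 r : R) : 0 < s -> 2 / 3 <= a -> a + s <= 1 ->
    cantor_cell a s -> t = s / 3 -> b = a + 2 / 3 * s ->
    (square_defect 1 a t <= r1%:E)%E -> (square_defect 1 b t <= r2%:E)%E ->
    r = t ^+ 2 + (r1 + r2) -> (square_defect 1 a s <= r%:E)%E.
  move=> s0 a0 a1 Cas -> -> H1 H2 ->.
  apply: (le_trans (square_defect_split P1 ltr01 s0 a0 a1 Cas)).
  by rewrite mul1r !EFinD leeD2l// leeD.
have cell a b s t : cantor_cell a s -> b = a + 2 / 3 * s -> t = s / 3 ->
    cantor_cell a t /\ cantor_cell b t.
  by move=> Cas -> ->; split; [exact: cantor_cellL|exact: cantor_cellR].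
have bound a s (r : R) : 0 < s -> 2 / 3 <= a -> a + s <= 1 -> cantor_cell a s ->
    r = s ^+ 2 / 7 -> (square_defect 1 a s <= r%:E)%E.
  by move=> s0 a0 a1 Cas ->; rewrite -[s ^+ 2]mul1r; exact: square_defect_le.
have C0 := @cantor_cell23 R.
have [||C1 C1'] := @cell _ (8 / 9) _ 9^-1 C0; [by field|by field|].
have [||C2 C2'] := @cell _ (20 / 27) _ 27^-1 C1; [by field|by field|].
have [||C3 C3'] := @cell _ (62 / 81) _ 81^-1 C2'; [by field|by field|].
have [||C4 C4'] := @cell _ (188 / 243) _ 243^-1 C3'; [by field|by field|].
have covered : (square_defect 1 (188 / 243) 243^-1 <= 0%:E)%E.
  rewrite square_defect0// => z /andP[zl zu].
  have [|||||||x [y [Cx Cy ->]]] := @cantor_mul_itv R (2 / 3) (8 / 9) 9^-1 z.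
  - by lra.
  - by lra.
  - by lra.
  - by lra.
  - exact: C1.
  - exact: C1'.
  - by apply/andP; split; lra.
  - by exists x, y.
pose q : R := (243 ^+ 2)^-1.
have E4 : (square_defect 1 (62 / 81) 243^-1 <= (q / 7)%:E)%E.
  by apply: (bound _ _ _ _ _ _ C4); rewrite /q; lra.
have E3 : (square_defect 1 (20 / 27) 81^-1 <= (9 * q / 7)%:E)%E.
  by apply: (bound _ _ _ _ _ _ C3); rewrite /q; lra.
have E2 : (square_defect 1 (2 / 3) 27^-1 <= (81 * q / 7)%:E)%E.
  by apply: (bound _ _ _ _ _ _ C2); rewrite /q; lra.
have E1 : (square_defect 1 (8 / 9) 9^-1 <= (729 * q / 7)%:E)%E.
  by apply: (bound _ _ _ _ _ _ C1'); rewrite /q; lra.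
have D3 : (square_defect 1 (62 / 81) 81^-1 <= (8 / 7 * q)%:E)%E.
  by apply: (merge _ _ _ _ _ _ _ _ _ _ C3' _ _ E4 covered); rewrite /q; lra.
have D2 : (square_defect 1 (20 / 27) 27^-1 <= (80 / 7 * q)%:E)%E.
  by apply: (merge _ _ _ _ _ _ _ _ _ _ C2' _ _ E3 D3); rewrite /q; lra.
have D1 : (square_defect 1 (2 / 3) 9^-1 <= (728 / 7 * q)%:E)%E.
  by apply: (merge _ _ _ _ _ _ _ _ _ _ C1 _ _ E2 D2); rewrite /q; lra.
by apply: (merge _ _ _ _ _ _ _ _ _ _ C0 _ _ D1 E1); rewrite /q; lra.
Qed.

Lemma cantor_products_div_exp3 n x y :
  cantor x -> cantor y -> P ((3 ^+ n)^-1 * (x * y)).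
Proof.
move=> Cx Cy; exists (x / 3 ^+ n), y; split=> //; first exact: cantor_div_exp3.
by rewrite mulrA [_^-1 * x]mulrC.
Qed.

(* [c / 9] is the length of [c / 3, 4 c / 9], which contains no product in its
   interior when [c] is a power of 1/3. *)
Lemma products_defect_split c (r : R) : 0 <= c ->
    (square_defect c (2 / 3) 3^-1 <= r%:E)%E ->
  (mu (`[0%R, c]%classic `\` P) <=
    (c / 9 + r)%:E + mu (`[0%R, (c / 3)%R]%classic `\` P))%E.
Proof.
move=> c0 cr; set X := `[0, c / 3]%classic `\` P.
have mI x y : measurable (`[x, y]%classic `\` P).
  by apply: measurableD => //; exact: measurable_itv.
set G := `[c / 3, (4 / 9 * c)]%classic.
have mG : measurable G by exact: measurable_itv.
set H := `[c * (2 / 3) ^+ 2, c * (2 / 3 + 3^-1) ^+ 2]%classic `\` P.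
have mGH : measurable (G `|` H) by apply: measurableU => //; exact: mI.
apply: (@le_trans _ _ (mu ((G `|` H) `|` X))).
  apply: le_measure; rewrite ?inE//; first exact: mI.
    by apply: measurableU => //; exact: mI.
  move=> z [/=]; rewrite in_itv /= => /andP[z0 zc] nPz.
  have [zX|zX] := leP z (c / 3).
    by right; split=> //=; rewrite in_itv /= z0 zX.
  left; have [zG|zG] := leP z (4 / 9 * c).
    by left; rewrite /G /= in_itv /= (ltW zX) zG.
  by right; split=> //=; rewrite in_itv /=; apply/andP; split; lra.
apply: (@le_trans _ _ (mu (G `|` H) + mu X)%E).
  by apply: measureU2 => //; exact: mI.
rewrite leeD2r// (@le_trans _ _ (mu G + mu H)%E)//.
  by apply: measureU2 => //; exact: mI.
rewrite EFinD leeD// /G lebesgue_measure_segment; last by lra.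
by rewrite lee_fin; lra.
Qed.

Lemma products_defect_le n :
  (mu (`[0%R, ((3 ^+ n)^-1)%R]%classic `\` P) <= ((3 ^+ n)^-1 * (4 / 21))%:E)%E.
Proof.
have bound k m : (mu (`[0%R, ((3 ^+ m)^-1)%R]%classic `\` P) <=
    ((3 ^+ m)^-1 * (4 / 21 + 3^-1 ^+ k))%:E)%E.
  elim: k m => [|k IHk] m; have c0 : 0 < (3 ^+ m)^-1 :> R
    by rewrite invr_gt0 exprn_gt0.
    apply: (@le_trans _ _ (mu `[0%R, ((3 ^+ m)^-1)%R]%classic)).
      apply: le_measure; rewrite ?inE.
      - by apply: measurableD => //; exact: measurable_itv.
      - exact: measurable_itv.
      - exact: subDsetl.
    rewrite lebesgue_measure_segment ?(ltW c0)// lee_fin expr0.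
    by lra.
  have D : (square_defect (3 ^+ m)^-1 (2 / 3) 3^-1 <=
      ((3 ^+ m)^-1 * 3^-1 ^+ 2 / 7)%:E)%E.
    apply: square_defect_le => //; last exact: cantor_cell23.
    - exact: cantor_products_div_exp3.
    - by lra.
  apply: (le_trans (products_defect_split (ltW c0) D)).
  have m1 : (3 ^+ m)^-1 / 3 = (3 ^+ m.+1)^-1 :> R by rewrite exprSr invfM.
  rewrite m1; apply: (le_trans (leeD (lexx _) (IHk m.+1))).
  rewrite -m1 -EFinD lee_fin (exprS _ k).
  by move: (3 ^+ m)^-1 (3^-1 ^+ k) => u v; lra.
apply: (@cvgn_gee (fun k => (3 ^+ n)^-1 * (4 / 21 + 3^-1 ^+ k))).
  by move=> k; exact: bound.
have -> : (3 ^+ n)^-1 * (4 / 21) = (3 ^+ n)^-1 * (4 / 21 + 0) :> R by rewrite addr0.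
apply: cvgM; first exact: cvg_cst.
apply: cvgD; first exact: cvg_cst.
by apply: cvg_expr; rewrite gtr0_norm//; lra.
Qed.

Lemma cantor_products_measure_gt : ((17 / 21 : R)%:E < mu P)%E.
Proof.
have D0 := products_defect_split ler01 square_defect1_le.
have D1 := products_defect_le 1.
set r : R := 1 / 9 + (63^-1 - (243 ^+ 2 * 7)^-1) + 3^-1 * (4 / 21).
have Dr : (mu (`[0%R, 1%R]%classic `\` P) <= r%:E)%E.
  rewrite (le_trans D0)// /r (EFinD (_ + _) (3^-1 * _)) leeD2l// div1r.
  by rewrite expr1 in D1.
have m01 : measurable (`[0, 1]%classic : set R) by exact: measurable_itv.
have tot : (1%:E <= mu P + r%:E)%E.
  apply: (@le_trans _ _ (mu P + mu (`[0%R, 1%R]%classic `\` P))%E); last exact: leeD2l.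
  have -> : 1%:E = mu `[0%R, 1%R]%classic by rewrite lebesgue_measure_segment// subr0.
  apply: (@le_trans _ _ (mu (P `|` (`[0, 1]%classic `\` P)))).
    apply: le_measure; rewrite ?inE//.
      by apply: measurableU => //; exact: measurableD.
    by move=> z z01; have [Pz|nPz] := pselect (P z); [left|right].
  by apply: measureU2 => //; exact: measurableD.
rewrite -leeBlDr// in tot; apply: lt_le_trans tot.
by rewrite -EFinB lte_fin /r; lra.
Qed.

End QuotientsAndProducts.

Theorem theorem1p1 (R : realType) :
  (* (1) *)
  (forall u : R, 0 <= u <= 1 ->
     exists x y, cantor_set x /\ cantor_set y /\ u = x ^+ 2 * y)
  /\
  (* (2) quotient set; 0 = 0/y is included explicitly, see NOTES.md *)
  ([set z | exists x y, [/\ cantor_set x, cantor_set y, y != 0 & z = x / y]]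
     = [set 0] `|` \bigcup_(m in [set: int])
          `[(2 / 3) * (3:R) ^ m, (3 / 2) * (3:R) ^ m]%classic)
  /\
  (* (3) product set *)
  (let P := [set z | exists x y, [/\ cantor_set x, cantor_set y & z = x * y]] in
   [/\ closed P, P `<=` `[0, 1]%classic
     & ((17 / 21 : R)%:E < (@lebesgue_measure R) P)%E]).
Proof.
split; first by move=> u u01; exact: cantor_sqM.
split; first exact: cantor_quotients.
split.
- exact: closed_cantor_products.
- exact: cantor_products_itv.
- exact: cantor_products_measure_gt.
Qed.
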